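(* Let $a>1$, $\lambda>0$. The program $$\min_{\beta\in\Lambda,\ g\in[0,\lambda]^d}\ \mathcal F_{\mathrm{SCAD}}(\beta,g)$$ is equivalent to $$\min_{\beta,g,h\in\mathbb R^d}\ \tfrac12\big(\beta^\top Q\beta+n(a-1)g^\top g+2n\,g^\top h\big)+q^\top\beta-na\lambda\mathbf 1^\top g$$ $$\text{s.t.}\quad \beta\in\Lambda;\quad h\ge\beta;\quad h\ge-\beta;\quad 0\le g\le\lambda.$$ (Vector inequalities are componentwise.)
   Context: Setting: $n$ is the sample size, $d$ the problem dimension, $0\le m<d$; $Q\in\mathbb R^{d\times d}$ is symmetric (not necessarily positive semidefinite), $q\in\mathbb R^d$, $\mathcal A\in\mathbb R^{d\times m}$ has full rank, $\mathbf b\in\mathbb R^m$, and $\Lambda:=\{\beta\in\mathbb R^d:\mathcal A^\top\beta\le\mathbf b\}$ is nonempty. $\mathbf 1$ is the all-ones vector. For $\beta=(\beta_i)\in\mathbb R^d$ and $g=(g_i)\in\mathbb R^d$, $$\mathcal F_{\mathrm{SCAD}}(\beta,g):=\tfrac12\beta^\top Q\beta+q^\top\beta+n\sum_{i=1}^d\Big\{(|\beta_i|-a\lambda)\cdot g_i+\tfrac12(a-1)\cdot g_i^2\Big\}.$$ Standing assumption: the SCAD penalized learning problem $\min_{\beta\in\Lambda}\tfrac12\beta^\top Q\beta+q^\top\beta+n\sum_{i=1}^dP_{\mathrm{SCAD},\lambda}(|\beta_i|)$ has a finite global solution, where $P_{\mathrm{SCAD},\lambda}(\theta)=\int_0^\theta\lambda\{\mathbb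 I(t\le\lambda)+\frac{(a\lambda-t)_+}{(a-1)\lambda}\mathbb I(t>\lambda)\}\,dt$ for $\theta\ge 0$, $\mathbb I(\cdot)$ is the indicator function and $(b)_+$ denotes the positive part of $b$. The word ''equivalent'' is the paper's own; the paper does not define it formally. *)

(* Defs.v *)
From HB Require Import structures.
From mathcomp Require Import all_boot all_order all_algebra.
From mathcomp Require Import all_classical all_reals all_analysis.

Set Implicit Arguments.
Unset Strict Implicit.
Unset Printing Implicit Defensive.

Import Order.TTheory GRing.Theory Num.Theory.
Import numFieldNormedType.Exports.

Local Open Scope classical_set_scope.
Local Open Scope ring_scope.

Section Programs.
Context {R : realType}.

Definition optimal_value (X : Type) (S : set X) (f : X -> R) : \bar R :=
  ereal_inf [set (f x)%:E | x in S].

Definition solutions (X : Type) (S : set X) (f : X -> R) : set X :=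
  [set x | S x /\ forall y, S y -> f x <= f y].

(* The program min_T g is min_S f with auxiliary variables, which [pi]
   forgets: the two are equivalent when they have the same optimal value and
   the global solutions of min_S f are exactly the projections of the global
   solutions of min_T g. *)
Definition equivalent_programs (X Y : Type) (pi : Y -> X)
    (S : set X) (f : X -> R) (T : set Y) (g : Y -> R) : Prop :=
  optimal_value S f = optimal_value T g /\
  solutions S f = pi @` solutions T g.

End Programs.

Section Scad.
Context {R : realType}.

Definition dotv d (u v : 'cV[R]_d) : R := (u^T *m v) ord0 ord0.

Definition lev k (u v : 'cV[R]_k) : Prop := forall i, u i ord0 <= v i ord0.

Definition polyhedron d m (A : 'M[R]_(d, m)) (b : 'cV[R]_m) : set 'cV[R]_d :=
  [set beta | lev (A^T *m beta) b].

Definition scad_penalty (a lambda theta : R) : R :=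
  \int[lebesgue_measure]_(t in `[0, theta])
    (lambda * ((t <= lambda)%R%:R +
       Num.max (a * lambda - t) 0 / ((a - 1) * lambda) * (lambda < t)%R%:R)).

Definition quad_loss d (Q : 'M[R]_d) (q beta : 'cV[R]_d) : R :=
  2^-1 * dotv beta (Q *m beta) + dotv q beta.

Definition scad_objective (n d : nat) (a lambda : R) (Q : 'M[R]_d)
    (q beta : 'cV[R]_d) : R :=
  quad_loss Q q beta +
  n%:R * \sum_(i < d) scad_penalty a lambda `|beta i ord0|.

Definition F_scad (n d : nat) (a lambda : R) (Q : 'M[R]_d)
    (q beta g : 'cV[R]_d) : R :=
  quad_loss Q q beta +
  n%:R * \sum_(i < d) ((`|beta i ord0| - a * lambda) * g i ord0 +
                       2^-1 * (a - 1) * g i ord0 ^+ 2).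

Definition F_feasible d m (lambda : R) (A : 'M[R]_(d, m)) (b : 'cV[R]_m) :
    set ('cV[R]_d * 'cV[R]_d) :=
  [set x | [/\ polyhedron A b x.1, lev 0 x.2 & lev x.2 (const_mx lambda)]].

Definition qp_objective (n d : nat) (a lambda : R) (Q : 'M[R]_d)
    (q beta g h : 'cV[R]_d) : R :=
  2^-1 * (dotv beta (Q *m beta) + n%:R * (a - 1) * dotv g g +
          2 * n%:R * dotv g h)
  + dotv q beta - n%:R * a * lambda * dotv (const_mx 1) g.

Definition qp_feasible d m (lambda : R) (A : 'M[R]_(d, m)) (b : 'cV[R]_m) :
    set ('cV[R]_d * 'cV[R]_d * 'cV[R]_d) :=
  [set x | let: (beta, g, h) := x in
    [/\ polyhedron A b beta, lev beta h, lev (- beta) h,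
        lev 0 g & lev g (const_mx lambda)]].

End Scad.

(* Main.v *)
Require Import Defs.
From HB Require Import structures.
From mathcomp Require Import all_boot all_order all_algebra.
From mathcomp Require Import all_classical all_reals all_analysis.
From mathcomp Require Import ring.

(** Writing h for an upper bound of |beta|, the quadratic objective exceeds
    F_SCAD(beta, g) by n times the sum of the g_i (h_i - |beta_i|)
    ([qp_objectiveE]). On the feasible set h >= beta and h >= -beta say exactly
    that h >= |beta|, and g >= 0, so this gap is nonnegative, and it vanishes
    for h = |beta|. Hence F_SCAD is the partial minimum of the quadratic
    objective over h, attained at every feasible (beta, g), and minimizing out
    a variable in this way preserves both the optimal value and the projected
    solution set ([equivalent_programs_lift]). *)

Set Implicit Arguments.
Unset Strict Implicit.
Unset Printing Implicit Defensive.

Import Order.TTheory GRing.Theory Num.Theory.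
Import numFieldNormedType.Exports.

Local Open Scope classical_set_scope.
Local Open Scope ring_scope.

(** A point of the lifted program never does better than its projection, and
    every point of the original program has a lift of equal value; so minimizers
    lift to minimizers and project to minimizers. *)
Lemma equivalent_programs_lift (R : realType) (X Y : Type) (pi : Y -> X)
    (S : set X) (f : X -> R) (T : set Y) (g : Y -> R) :
    (forall y, T y -> S (pi y) /\ f (pi y) <= g y) ->
    (forall x, S x -> exists y, [/\ T y, pi y = x & g y = f x]) ->
  equivalent_programs pi S f T g.
Proof.
move=> proj lift; split.
  apply/eqP; rewrite eq_le; apply/andP; split; apply: le_ereal_inf_tmp => _ [x Hx <-].
    have [Spx le_fg] := proj _ Hx.
    apply: (@le_trans _ _ (f (pi x))%:E); last by rewrite lee_fin.
    by apply: ereal_inf_lbound; exists (pi x).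
  have [y [Ty _ <-]] := lift _ Hx.
  by apply: ereal_inf_lbound; exists y.
apply/seteqP; split=> [x [Sx min_x]|_ [y [Ty min_y] <-]].
  have [y [Ty pi_y gy]] := lift _ Sx.
  exists y => //; split=> // z /proj[Spz le_fg].
  by rewrite gy (le_trans (min_x _ Spz)).
have [Spy le_fg] := proj _ Ty.
split=> // x /lift[z [Tz _ <-]].
exact: le_trans le_fg (min_y _ Tz).
Qed.

Lemma dotvE (R : realType) d (u v : 'cV[R]_d) :
  dotv u v = \sum_i u i ord0 * v i ord0.
Proof. by rewrite /dotv mxE; apply: eq_bigr => i _; rewrite mxE. Qed.

(** The loss of beta and the terms in g alone agree on both sides, so replacing
    each |beta_i| by h_i changes the objective linearly, with slope n g_i. *)
Lemma qp_objectiveE (R : realType) (n d : nat) (a lambda : R) (Q : 'M[R]_d)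
    (q beta g h : 'cV[R]_d) :
  qp_objective n a lambda Q q beta g h =
  F_scad n a lambda Q q beta g +
  n%:R * \sum_i g i ord0 * (h i ord0 - `|beta i ord0|).
Proof.
have -> : qp_objective n a lambda Q q beta g h = quad_loss Q q beta +
    n%:R * (2^-1 * (a - 1) * dotv g g + dotv g h
            - a * lambda * dotv (const_mx 1) g).
  by rewrite /qp_objective /quad_loss; field.
rewrite /F_scad -[RHS]addrA -[in RHS]mulrDr !dotvE !mulr_sumr -sumrN -!big_split /=.
by congr (_ + _ * _); apply: eq_bigr => i _; rewrite mxE; ring.
Qed.

Lemma lev_abs (R : realType) d (u h : 'cV[R]_d) :
  lev u h -> lev (- u) h -> forall i, `|u i ord0| <= h i ord0.
Proof.
move=> le_uh le_Nuh i; rewrite ler_norml lerNl le_uh andbT.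
by have := le_Nuh i; rewrite mxE.
Qed.

Theorem corollary2p2 (R : realType) (n d m : nat) (hmd : (m < d)%N)
  (Q : 'M[R]_d) (hQ : Q^T = Q) (q : 'cV[R]_d)
  (A : 'M[R]_(d, m)) (hA : \rank A = m) (b : 'cV[R]_m)
  (hLambda : polyhedron A b !=set0)
  (a lambda : R) (ha : 1 < a) (hlambda : 0 < lambda)
  (hsol : solutions (polyhedron A b) (scad_objective n a lambda Q q) !=set0) :
  equivalent_programs
    (fun x : 'cV[R]_d * 'cV[R]_d * 'cV[R]_d => x.1)
    (F_feasible lambda A b)
    (fun x => F_scad n a lambda Q q x.1 x.2)
    (qp_feasible lambda A b)
    (fun x => qp_objective n a lambda Q q x.1.1 x.1.2 x.2).
Proof.
apply: equivalent_programs_lift.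
  move=> [[beta g] h] /= [Lbeta le_bh le_Nbh g_ge0 g_le]; split; first by [].
  rewrite qp_objectiveE lerDl mulr_ge0 // sumr_ge0 // => i _.
  rewrite mulr_ge0 //; first by have := g_ge0 i; rewrite mxE.
  by rewrite subr_ge0 lev_abs.
(* The lift h = |beta| makes every h_i - |beta_i| vanish. *)
move=> [beta g] /= [Lbeta g_ge0 g_le].
exists (beta, g, map_mx Num.norm beta); split=> //=.
  by split=> // i; rewrite !mxE ?ler_norm // -normrN ler_norm.
rewrite qp_objectiveE big1 ?mulr0 ?addr0 // => i _.
by rewrite mxE subrr mulr0.
Qed.
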